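(* Let $n\ge1$. The map $\phi=\Phi_{\mathrm{FV}}^{-1}\circ\xi\circ\Phi_{\mathrm{FV}}:\mathfrak S_n\to\mathfrak S_n$ is a bijection such that for every $\pi\in\mathfrak S_n$, componentwise as equalities of (multi)sets, $$(\mathrm{Dtb},\mathrm{Dta},\mathrm{Abb},\mathrm{Aba},\mathbf 2\underline{13},\mathbf 2\underline{31},\underline{31}\mathbf 2)(\pi)=\kappa_{n+1}\circ(\mathrm{Aba},\mathrm{Abb},\mathrm{Dta},\mathrm{Dtb},\mathbf 2\underline{31},\mathbf 2\underline{13},\underline{31}\mathbf 2)(\phi(\pi)),$$ $$[n-1]\setminus\mathrm{Db}(\pi)=\kappa_n(\mathrm{Db}(\phi(\pi))),\qquad [n-1]\setminus\mathrm{Ides}(\pi)=\kappa_n(\mathrm{Ides}(\phi(\pi))).$$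
   Context: $[n]=\{1,\dots,n\}$; $\mathfrak S_n$ is the set of permutations of $[n]$, written $\pi=\pi(1)\cdots\pi(n)$. For a multiset $S$, $\kappa_N(S)$ is the multiset obtained by replacing each element $s$ (with multiplicity) by $N-s$; it is applied componentwise to tuples. Histories. A 2-Motzkin path of length $n$ is a word $w=w_1\cdots w_n$ over $\{\mathrm N,\mathrm S,\mathrm E,\mathrm{dE}\}$ such that, with $h_i:=\#\{j<i: w_j=\mathrm N\}-\#\{j<i: w_j=\mathrm S\}$ for $1\le i\le n+1$, one has $h_i\ge 0$ for all $i$ and $h_{n+1}=0$. An sr-Laguerre history of length $n$ is a triple $W=(w,h,c)$ where $w$ is a 2-Motzkin path of length $n$, $h=h_1\cdots h_n$ is its height sequence, and $c=c_1\cdots c_n$ is a sequence of integers with $0\le c_i\le h_i$ if $w_i\in\{\mathrm N,\mathrm E\}$ and $1\le c_i\le h_i$ if $w_i\in\{\mathrm S,\mathrm{dE}\}$. $\mathfrak L_n$ is the set of all of these; $\mathrm{cs}(W):=\max\{i\in[n]: c_i=0\}$. The map $\xi:\mathfrak L_n\to\mathfrak L_n$ is the unique involution such that for $W=(w,h,c)$ with $\mathrm{cs}(W)=m$ and $\xi(W)=(v,g,b)$: (1) $\mathrm{cs}(\xi(W))=n+1-m$; (2) for $j\ne n+1-m$, $v_j\in\{\mathrm N,\mathrm E\}$ iff $w_{n+1-j}\in\{\mathrm S,\mathrm{dE}\}$; (3) $g_j=h_{n+1-j}+1$ if $j>n+1-m$ and $v_j\in\{\mathrm S,\mathrm{dE}\}$,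 $g_j=h_{n+1-j}-1$ if $j<n+1-m$ and $v_j\in\{\mathrm N,\mathrm E\}$, and $g_j=h_{n+1-j}$ otherwise; (4) $b_j=g_j-h_{n+1-j}+c_{n+1-j}$ for all $j\in[n]$. The bijection $\Phi_{\mathrm{FV}}:\mathfrak S_n\to\mathfrak L_n$. Put $\pi(0)=-\infty$, $\pi(n+1)=+\infty$. Then $\Phi_{\mathrm{FV}}(\pi)=(w,h,c)$ where, for $i=\pi(k)$: $w_i=\mathrm S$ if $\pi(k-1)<\pi(k)>\pi(k+1)$; $w_i=\mathrm N$ if $\pi(k-1)>\pi(k)<\pi(k+1)$; $w_i=\mathrm E$ if $\pi(k-1)<\pi(k)<\pi(k+1)$; $w_i=\mathrm{dE}$ if $\pi(k-1)>\pi(k)>\pi(k+1)$; $h$ is the height sequence of $w$; and $c_i=\#\{j: k<j<n,\ \pi(j+1)<\pi(k)<\pi(j)\}+\chi(w_i\in\{\mathrm S,\mathrm{dE}\})$, where $\chi$ is $1$ if the statement is true and $0$ otherwise. Permutation statistics. $\mathrm{Des}(\pi)=\{i\in[n-1]:\pi(i)>\pi(i+1)\}$; $\mathrm{Dt}(\pi)=\{\pi(i): i\in\mathrm{Des}(\pi)\}$; $\mathrm{Db}(\pi)=\{\pi(i+1): i\in\mathrm{Des}(\pi)\}$; $\mathrm{Ab}(\pi)=\{\pi(i): 1\le i<n,\ \pi(i)<\pi(i+1)\}$; $\mathrm{Ides}(\pi)=\mathrm{Des}(\pi^{-1})$. $\mathrm{Dtb},\mathrm{Abb}$ (resp. $\mathrm{Dta},\mathrm{Aba}$)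 of $\pi$ are the subsets of $\mathrm{Dt}(\pi),\mathrm{Ab}(\pi)$ of elements $<\pi(n)$ (resp. $>\pi(n)$). $\mathbf 2\underline{13}(\pi)$ (resp. $\mathbf 2\underline{31}(\pi)$) is the multiset in which $\pi(i)$ has multiplicity $\#\{j: i<j<n,\ \pi(j)<\pi(i)<\pi(j+1)\}$ (resp. $\#\{j: i<j<n,\ \pi(j+1)<\pi(i)<\pi(j)\}$); $\underline{31}\mathbf 2(\pi)$ is the multiset in which $\pi(i)$ has multiplicity $\#\{j: 1\le j<i-1,\ \pi(j+1)<\pi(i)<\pi(j)\}$. *)

(* Defs.v *)
From Stdlib Require Import ClassicalEpsilon.
From HB Require Import structures.
From mathcomp Require Import all_boot all_order all_fingroup all_algebra.
From mathcomp Require Import finmap multiset zify.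

Set Implicit Arguments.
Unset Strict Implicit.
Unset Printing Implicit Defensive.

Import Order.TTheory GRing.Theory Num.Theory.

Local Open Scope fset_scope.
Local Open Scope mset_scope.
Local Open Scope nat_scope.

(* Positions and values are 1-based throughout, as in [n] = {1, ..., n}.      *)

Inductive step := stN | stS | stE | stdE.

Definition step_code (s : step) : bool * bool :=
  match s with
  | stN => (false, false) | stS => (false, true)
  | stE => (true, false) | stdE => (true, true)
  end.

Definition step_decode (b : bool * bool) : step :=
  match b with
  | (false, false) => stN | (false, true) => stS
  | (true, false) => stE | (true, true) => stdE
  end.

Lemma step_codeK : cancel step_code step_decode. Proof. by case. Qed.

HB.instance Definition _ := Equality.copy step (can_type step_codeK).

Definition NE : seq step := [:: stN; stE].
Definition SdE : seq step := [:: stS; stdE].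

(* The prefix of the i.-1 first letters of w consists of the w_j with j < i.  *)
Definition height (w : seq step) (i : nat) : int :=
  ((count_mem stN (take i.-1 w))%:Z - (count_mem stS (take i.-1 w))%:Z)%R.

Definition Motzkin2 (w : seq step) : bool :=
  all (fun i => (0 <= height w i)%R) (iota 1 (size w).+1)
  && (height w (size w).+1 == 0%R).

Definition triple n := (n.-tuple step * n.-tuple int * n.-tuple int)%type.

Definition letter n (W : triple n) (i : nat) : step := nth stE W.1.1 i.-1.
Definition ht n (W : triple n) (i : nat) : int := nth 0%R W.1.2 i.-1.
Definition lab n (W : triple n) (i : nat) : int := nth 0%R W.2 i.-1.

Definition is_history n (W : triple n) : bool :=
  [&& Motzkin2 W.1.1,
      all (fun i => ht W i == height W.1.1 i) (iota 1 n)
    & all (fun i => ((if letter W i \in NE then 0 else 1) <= lab W i <= ht W i)%R)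
          (iota 1 n)].

Definition history n := {W : triple n | is_history W}.

Definition cs n (W : triple n) : nat :=
  \max_(1 <= i < n.+1 | lab W i == 0%R) i.

Definition xi_rel n (W V : triple n) : Prop :=
  let m := cs W in
  [/\ cs V = n.+1 - m,
      forall j, 1 <= j <= n -> j <> n.+1 - m ->
        (letter V j \in NE) <-> (letter W (n.+1 - j) \in SdE),
      forall j, 1 <= j <= n ->
        ht V j =
          if (n.+1 - m < j) && (letter V j \in SdE) then (ht W (n.+1 - j)%N + 1)%R
          else if (j < n.+1 - m) && (letter V j \in NE) then (ht W (n.+1 - j)%N - 1)%R
          else ht W (n.+1 - j)
    & forall j, 1 <= j <= n ->
        lab V j = (ht V j - ht W (n.+1 - j)%N + lab W (n.+1 - j)%N)%R].

Definition is_xi n (f : history n -> history n) : Prop :=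
  involutive f /\ forall W, xi_rel (val W) (val (f W)).

(* The unique map satisfying [is_xi]: xi_rel W V determines V, since the      *)
(* heights of V determine its word up to the choice between stE and stdE,     *)
(* which is fixed by the second clause (and by lab V j = 0 at j = n + 1 - m). *)
Definition xi n : history n -> history n := epsilon (inhabits id) (@is_xi n).

(* ol is the one-line notation: ol pi k = pi(k) for 1 <= k <= n.  The values  *)
(* ol pi 0 = 0 and ol pi n.+1 = n.+1 play the roles of -oo and +oo, as they   *)
(* are only ever compared with values in [n].                                 *)
Definition ol n (pi : 'S_n) (k : nat) : nat :=
  if k is k'.+1 then (if insub k' is Some i then (pi i).+1 else n.+1) else 0.

Arguments ol : simpl never.

Definition FV_letter n (pi : 'S_n) (i : nat) : step :=
  let k := ol pi^-1 i in
  match ol pi k.-1 < ol pi k, ol pi k < ol pi k.+1 with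
  | true, false => stS
  | false, true => stN
  | true, true => stE
  | false, false => stdE
  end.

Definition FV_lab n (pi : 'S_n) (i : nat) : int :=
  let k := ol pi^-1 i in
  Posz (count (fun j => ol pi j.+1 < ol pi k < ol pi j) (index_iota k.+1 n)
        + (FV_letter pi i \in SdE)).

Definition FV_word n (pi : 'S_n) : n.-tuple step :=
  [tuple FV_letter pi i.+1 | i < n].

Definition FV_triple n (pi : 'S_n) : triple n :=
  (FV_word pi, [tuple height (FV_word pi) i.+1 | i < n],
   [tuple FV_lab pi i.+1 | i < n]).

Section FVHistory.

Variables (n : nat) (pi : 'S_n).

Lemma ol_out (s : 'S_n) : ol s n.+1 = n.+1.
Proof. by rewrite /ol insubN // ltnn. Qed.

Lemma ol_in (s : 'S_n) k (hk : k < n) : ol s k.+1 = (s (Ordinal hk)).+1.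
Proof. by rewrite /ol insubT. Qed.

Lemma ol_bound (s : 'S_n) k : 1 <= k <= n -> 1 <= ol s k <= n.
Proof.
by case: k => // k hk; rewrite (ol_in s hk) /= ltn_ord.
Qed.

Lemma olK k : 1 <= k <= n -> ol pi^-1 (ol pi k) = k.
Proof.
case: k => // k hk; rewrite (ol_in pi hk).
by rewrite (ol_in _ (ltn_ord (pi _))) (_ : Ordinal _ = pi (Ordinal hk))
  ?permK //; apply: val_inj.
Qed.

Lemma olVK i : 1 <= i <= n -> ol pi (ol pi^-1 i) = i.
Proof.
case: i => // i hi; rewrite (ol_in _ hi).
by rewrite (ol_in _ (ltn_ord (pi^-1%g _)))
  (_ : Ordinal (ltn_ord _) = pi^-1%g (Ordinal hi)) ?permKV //; apply: val_inj.
Qed.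

Lemma nth_FV T (x0 : T) (F : nat -> T) i : i < n ->
  nth x0 [tuple F (val j).+1 | j < n] i = F i.+1.
Proof. by move=> hi; rewrite (nth_mktuple _ _ (Ordinal hi)). Qed.

Let crossings i :=
  count (fun k => ol pi k.+1 < i <= ol pi k) (iota 0 n.+1).

Lemma ol_ext_neq i k : 1 <= i <= n -> k <= n.+1 -> k != ol pi^-1 i -> ol pi k != i.
Proof.
move=> hi hk; apply: contra => /eqP e.
have [k0|k0] := posnP k; first by move: e; rewrite k0 /ol; lia.
have [kn|kn] := leqP k n; first by rewrite -e olK // k0 kn.
have kE : k = n.+1 by lia.
by move: e; rewrite kE ol_out; lia.
Qed.

Lemma crossingsS i : 1 <= i <= n ->
  ((crossings i.+1)%:Z = (crossings i)%:Z
     + (FV_letter pi i == stN)%:Z - (FV_letter pi i == stS)%:Z)%R.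
Proof.
move=> hi; have pV := ol_bound pi^-1 hi.
set p := ol pi^-1 i in pV.
have ip : ol pi p = i by rewrite olVK.
have nq k : k <= n.+1 -> k != p -> ol pi k != i by exact: ol_ext_neq.
have spl : iota 0 n.+1 = (iota 0 p.-1 ++ [:: p.-1; p] ++ iota p.+1 (n - p))%SEQ.
  have -> : n.+1 = p.-1 + (2 + (n - p)) by lia.
  rewrite iotaD; congr (_ ++ _)%SEQ; rewrite add0n /=.
  by have -> : p.-1.+1 = p by lia.
have eqc s : {in s, forall k, [/\ k <= n, k != p & k.+1 != p]} ->
    count (fun k => ol pi k.+1 < i.+1 <= ol pi k) s =
    count (fun k => ol pi k.+1 < i <= ol pi k) s.
  move=> hs; apply: eq_in_count => k /hs[h1 h2 h3].
  have := nq k.+1 h1 h3; have := nq k (leqW h1) h2; lia.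
rewrite /crossings spl !count_cat (eqc (iota 0 p.-1)); last first.
  by move=> k; rewrite mem_iota => ?; split; lia.
rewrite (eqc (iota p.+1 _)); last first.
  by move=> k; rewrite mem_iota => ?; split; lia.
have pS : p.-1.+1 = p by lia.
rewrite /= pS ip /FV_letter -/p ip.
have := nq p.-1; have := nq p.+1.
have nSN : (stS == stN) = false by [].
have nNS : (stN == stS) = false by [].
have nEN : (stE == stN) = false by [].
have nES : (stE == stS) = false by [].
have nDN : (stdE == stN) = false by [].
have nDS : (stdE == stS) = false by [].
by case E1: (ol pi p.-1 < i); case E2: (i < ol pi p.+1);
  rewrite ?eqxx ?nSN ?nNS ?nEN ?nES ?nDN ?nDS; lia.
Qed.

Lemma FV_height i : 1 <= i <= n.+1 -> height (FV_word pi) i = Posz (crossings i).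
Proof.
case: i => // i; elim: i => [_|i IH hi].
  rewrite /height take0 /= /crossings (@eq_in_count _ _ pred0) ?count_pred0 //.
  move=> k; rewrite mem_iota => hk; apply/negbTE; rewrite negb_and -leqNgt.
  have [kn|kn] := ltnP k n; first by have := @ol_bound pi k.+1; lia.
  have -> : k = n by lia.
  by rewrite ol_out.
have hin : i < n by lia.
rewrite crossingsS ?hin // -IH; last by lia.
have sz : i < size (FV_word pi) by rewrite size_tuple.
rewrite /height [i.+2.-1]/= (take_nth stE sz) -cats1 !count_cat /= !addn0.
have -> : nth stE (FV_word pi) i = FV_letter pi i.+1.
  by rewrite (nth_FV stE (FV_letter pi)).
lia.
Qed.

Lemma FV_history : is_history (FV_triple pi).
Proof.
have last0 : crossings n.+1 = 0.
  rewrite /crossings (@eq_in_count _ _ pred0) ?count_pred0 //.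
  move=> k; rewrite mem_iota => hk; apply/negbTE; rewrite negb_and -!ltnNge.
  case: k hk => [|k] hk; first by rewrite /ol orbT.
  by have := @ol_bound pi k.+1; lia.
apply/and3P; split.
- rewrite /Motzkin2 size_tuple FV_height ?leqnn // last0 eqxx andbT.
  by apply/allP => i; rewrite mem_iota => hi; rewrite FV_height.
- apply/allP => -[|i]; rewrite mem_iota => hi; first by lia.
  have hin : i < n by lia.
  by rewrite /ht (nth_FV 0%R (height (FV_word pi))).
- apply/allP => -[|i]; rewrite mem_iota => hi; first by lia.
  have hin : i < n by lia.
  have -> : letter (FV_triple pi) i.+1 = FV_letter pi i.+1.
    by rewrite /letter (nth_FV stE (FV_letter pi)).
  have -> : lab (FV_triple pi) i.+1 = FV_lab pi i.+1.
    by rewrite /lab (nth_FV 0%R (FV_lab pi)).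
  have -> : ht (FV_triple pi) i.+1 = Posz (crossings i.+1).
    rewrite -FV_height; last by lia.
    by rewrite /ht (nth_FV 0%R (height (FV_word pi))).
  have pV : 1 <= ol pi^-1 i.+1 <= n by apply: ol_bound; lia.
  rewrite /FV_lab; set p := ol pi^-1 i.+1 in pV *.
  have ip : ol pi p = i.+1 by rewrite olVK //; lia.
  set c := count _ (index_iota _ _).
  have cr : c + (ol pi p.+1 < ol pi p) <= crossings i.+1.
    rewrite /crossings (_ : n.+1 = p + (1 + ((n - p.+1) + (n - p - (n - p.+1)))));
      last by lia.
    rewrite !iotaD add0n addn1 /= !count_cat /= ip leqnn andbT count_cat.
    have : c <= count (fun k => ol pi k.+1 < i.+1 <= ol pi k) (iota p.+1 (n - p.+1)).
      by apply: sub_count => k; rewrite ip /=; lia.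
    lia.
  have nq : ol pi p.+1 != i.+1 by apply: ol_ext_neq; rewrite -/p; lia.
  move: cr; rewrite /FV_letter -/p ip.
  case E1: (ol pi p.-1 < i.+1); case E2: (i.+1 < ol pi p.+1) => cr;
    set x := (X in X \in NE); set y := (_ \in SdE);
    first [have -> : y = true by [] | have -> : y = false by []];
    first [have -> : x \in NE = true by [] | have -> : x \in NE = false by []];
    move: cr; rewrite !lez_nat; lia.
Qed.

End FVHistory.

Definition Phi_FV n (pi : 'S_n) : history n := exist _ (FV_triple pi) (FV_history pi).

Definition Phi_FV_inv n (W : history n) : 'S_n :=
  odflt 1%g [pick pi | Phi_FV pi == W].

Definition phi n : 'S_n -> 'S_n := @Phi_FV_inv n \o @xi n \o @Phi_FV n.

Section Statistics.

Variables (n : nat) (pi : 'S_n).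

Definition Des : {fset nat} := [fset i in iota 1 n.-1 | ol pi i.+1 < ol pi i].
Definition Dt : {fset nat} := [fset ol pi i | i in Des].
Definition Db : {fset nat} := [fset ol pi i.+1 | i in Des].
Definition Ab : {fset nat} :=
  [fset ol pi i | i in iota 1 n.-1 & ol pi i < ol pi i.+1].

Definition Dtb : {fset nat} := [fset x in Dt | x < ol pi n].
Definition Dta : {fset nat} := [fset x in Dt | ol pi n < x].
Definition Abb : {fset nat} := [fset x in Ab | x < ol pi n].
Definition Aba : {fset nat} := [fset x in Ab | ol pi n < x].

(* The multiset in which pi(i) has multiplicity f i, for 1 <= i <= n.         *)
Definition mset_of_mult (f : nat -> nat) : {mset nat} :=
  seq_mset (flatten [seq nseq (f i) (ol pi i) | i <- iota 1 n]).

(* Vincular patterns: the bold letter (here after b) records the value, the   *)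
(* underlined letters (here after u) are adjacent in pi.                      *)
Definition b2_u13 : {mset nat} := mset_of_mult (fun i =>
  count (fun j => ol pi j < ol pi i < ol pi j.+1) (index_iota i.+1 n)).
Definition b2_u31 : {mset nat} := mset_of_mult (fun i =>
  count (fun j => ol pi j.+1 < ol pi i < ol pi j) (index_iota i.+1 n)).
Definition u31_b2 : {mset nat} := mset_of_mult (fun i =>
  count (fun j => ol pi j.+1 < ol pi i < ol pi j) (index_iota 1 i.-1)).

End Statistics.

Definition Ides n (pi : 'S_n) : {fset nat} := Des pi^-1.

(* Complementation; only applied to (multi)sets of numbers at most N, so the  *)
(* subtraction is never truncated.                                            *)
Definition kappa (N : nat) (A : {fset nat}) : {fset nat} := [fset N - x | x in A].
Definition mkappa (N : nat) (A : {mset nat}) : {mset nat} :=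
  seq_mset [seq N - x | x <- A].

Definition intv (m : nat) : {fset nat} := [fset i in iota 1 m].

(* Main.v *)
(* Call i a top if its letter in w is S or dE (a descent top of pi) and a
   bottom if it is N or dE (a descent bottom).  The height sequence moves by
   h_{i+1} - h_i = [i bottom] - [i top], and h_i - c_i is the number of descents
   of pi straddling i to the left of i.  With m = pi(n) = cs(W), the clauses
   defining xi say that at j = n+1-i the tops are complemented (except at i = m),
   g_j = h_i - [i top] + [i < m] and b_j = c_i - [i top] + [i < m].  Hence g - b
   is the reversal of h - c, which gives the statistic (31)2; taking differences
   of g shows that n-i is a bottom of phi(pi) iff i is not one of pi; and counting
   the ascents minus the descents straddling i after i turns b_j into 2(13) and
   2(31).  Finally i+1 precedes i in pi iff the left count of i+1 is less than the
   left count of i plus [i bottom], a condition which xi negates under i -> n-i.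

   More generally the relative order of t+1 and any i <= t can be read off the
   history, so Phi_FV is injective; it is surjective by inserting 1, ..., n
   successively into the slots of a partial word. *)

From Stdlib Require Import ClassicalEpsilon.
Require Import Defs.
From mathcomp Require Import all_boot all_order all_fingroup all_algebra.
From mathcomp Require Import finmap multiset zify.

Set Implicit Arguments.
Unset Strict Implicit.
Unset Printing Implicit Defensive.

Import Order.TTheory GRing.Theory Num.Theory.
Local Open Scope nat_scope.

(** * The involution xi *)

Definition is_dt (s : step) := match s with stS | stdE => true | _ => false end.
Definition is_db (s : step) := match s with stN | stdE => true | _ => false end.

(** A letter amounts to two independent bits, descent top and descent bottom, and words are built
    and compared bit by bit. *)
Definition mk_step (top bot : bool) : step :=
  match top, bot with
  | true, true => stdE | true, false => stS
  | false, true => stN | false, false => stE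
  end.

Lemma is_dt_mk t b : is_dt (mk_step t b) = t. Proof. by case: t; case: b. Qed.
Lemma is_db_mk t b : is_db (mk_step t b) = b. Proof. by case: t; case: b. Qed.
Lemma mk_stepK s : mk_step (is_dt s) (is_db s) = s. Proof. by case: s. Qed.
Lemma in_SdE s : (s \in SdE) = is_dt s. Proof. by case: s. Qed.
Lemma in_NE s : (s \in NE) = ~~ is_dt s. Proof. by case: s. Qed.

Lemma height1 w : height w 1 = 0%R.
Proof. by rewrite /height take0. Qed.

Lemma heightS w i : i < size w ->
  height w i.+2 = (height w i.+1 + (is_db (nth stE w i))%:Z
                   - (is_dt (nth stE w i))%:Z)%R.
Proof.
move=> hi; rewrite /height /= (take_nth stE hi) -cats1 !count_cat /= !addn0.
have -> s : (s == stN) = is_db s && ~~ is_dt s by case: s.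
have -> s : (s == stS) = is_dt s && ~~ is_db s by case: s.
by case: (nth stE w i) => /=; lia.
Qed.

Section Triples.
Variable n : nat.
Implicit Types W V : triple n.

Lemma triple_ext W V :
  (forall i, 1 <= i <= n -> letter W i = letter V i) ->
  (forall i, 1 <= i <= n -> ht W i = ht V i) ->
  (forall i, 1 <= i <= n -> lab W i = lab V i) -> W = V.
Proof.
have aux T (x0 : T) (s t : n.-tuple T) :
    (forall i, 1 <= i <= n -> nth x0 s i.-1 = nth x0 t i.-1) -> s = t.
  move=> e; apply/val_inj/(@eq_from_nth _ x0); rewrite ?size_tuple // => i hi.
  by apply: (e i.+1).
case: W => -[w h] c; case: V => -[w' h'] c' /= ew eh ec.
by congr (_, _, _); [exact: aux ew | exact: aux eh | exact: aux ec].
Qed.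

(** * Labels and heights of a history, and the position [cs] *)

Section History.
Variables (W : triple n) (hW : is_history W).

Lemma history_ht i : 1 <= i <= n -> ht W i = height W.1.1 i.
Proof.
move=> hi; case/and3P: hW => _ /allP h _; apply/eqP/h.
by rewrite mem_iota; lia.
Qed.

Lemma history_lab i : 1 <= i <= n ->
  ((is_dt (letter W i))%:Z <= lab W i <= ht W i)%R.
Proof.
move=> hi; case/and3P: hW => _ _ /allP/(_ i).
by rewrite mem_iota in_NE; case: (is_dt _) => /= -> //; lia.
Qed.

Lemma history_ht1 : 1 <= n -> ht W 1 = 0%R.
Proof. by move=> hn; rewrite history_ht ?height1 ?hn. Qed.

Lemma history_htS i : 1 <= i < n ->
  ht W i.+1 = (ht W i + (is_db (letter W i))%:Z - (is_dt (letter W i))%:Z)%R.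
Proof.
case: i => // i hi; rewrite !history_ht; try lia.
by rewrite heightS // size_tuple; lia.
Qed.

Lemma history_htn : 1 <= n ->
  (ht W n + (is_db (letter W n))%:Z - (is_dt (letter W n))%:Z)%R = 0%R.
Proof.
move=> hn; case/and3P: hW => /andP[_ /eqP <-] _ _.
rewrite history_ht ?hn ?leqnn // size_tuple /letter.
case: (n) hn W.1.1 => // k _ w.
by rewrite heightS ?size_tuple.
Qed.

(** The path ends at height 0, while the last height minus the top bit is already nonnegative, the
    label lying between the two. *)
Lemma history_dbn : 1 <= n -> is_db (letter W n) = false.
Proof.
move=> hn; have := history_htn hn; have := @history_lab n.
by case: (is_db _); case: (is_dt _); lia.
Qed.

Lemma history_cs : 1 <= n ->
  [/\ 1 <= cs W <= n, lab W (cs W) = 0%R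
    & forall i, cs W < i <= n -> (1 <= lab W i)%R].
Proof.
move=> hn.
(* Squeezed by [ht W 1 = 0]; hence the maximum [cs W] ranges over a nonempty set and is not the
   default 0. *)
have l1 : lab W 1 = 0%R.
  by have := @history_lab 1; have := history_ht1 hn; lia.
have max_le i : 1 <= i <= n -> lab W i == 0%R -> i <= cs W.
  move=> hi l0; rewrite /cs big_nat_cond.
  have := @leq_bigmax_seq _ (index_iota 1 n.+1)
    (fun i => (1 <= i < n.+1) && (lab W i == 0%R)) id i.
  by apply; rewrite ?mem_index_iota ?l0 ?andbT; lia.
have cs_lab : (cs W <= n) && (lab W (cs W) == 0%R).
  have : (cs W <= n) && ((0 < cs W) ==> (lab W (cs W) == 0%R)).
    rewrite /cs big_nat_cond; elim/big_ind: _ => //.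
      by move=> x y hx hy; rewrite /maxn; case: ifP.
    by move=> i /andP[hi ->]; rewrite implybT; lia.
  by have := max_le 1; rewrite l1 eqxx hn => /(_ isT isT) -> .
have := max_le 1; rewrite l1 eqxx hn => /(_ isT isT) cs1.
case/andP: cs_lab => cn /eqP c0; split => //; first by rewrite cs1.
move=> i hi; have := max_le i; have := @history_lab i; lia.
Qed.

Lemma history_dt_cs : 1 <= n -> is_dt (letter W (cs W)) = false.
Proof.
move=> hn; have [c1 c0 _] := history_cs hn.
by have := history_lab c1; rewrite c0; case: (is_dt _).
Qed.

End History.

Lemma cs_unique V m : 1 <= m <= n -> lab V m = 0%R ->
  (forall j, m < j <= n -> lab V j <> 0%R) -> cs V = m.
Proof.
move=> hm l0 lj; apply/eqP; rewrite eqn_leq; apply/andP; split.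
  rewrite /cs big_nat_cond; apply/bigmax_leqP_seq => i _ /andP[/andP[i1 i2] /eqP li].
  by rewrite leqNgt; apply/negP => mi; apply: (lj i) => //; rewrite mi; lia.
rewrite /cs big_nat_cond.
by have := @leq_bigmax_seq _ (index_iota 1 n.+1)
    (fun i => (1 <= i < n.+1) && (lab V i == 0%R)) id m;
  apply; rewrite ?mem_index_iota ?l0 ?eqxx ?andbT; lia.
Qed.

(** Clauses (2) to (4) read at [j = n.+1 - i], the three cases of (3) merging into one formula.
    Clause (2) is silent at [cs W], but there both histories carry the label 0, which a top cannot
    have. *)
Lemma xi_rel_ht W V : is_history W -> is_history V -> xi_rel W V -> 1 <= n ->
  forall i, 1 <= i <= n ->
  [/\ is_dt (letter V (n.+1 - i)) = ~~ is_dt (letter W i) && (i != cs W),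
      ht V (n.+1 - i) = (ht W i - (is_dt (letter W i))%:Z + (i < cs W)%:Z)%R
    & lab V (n.+1 - i) = (lab W i - (is_dt (letter W i))%:Z + (i < cs W)%:Z)%R].
Proof.
move=> hW hV [x1 x2 x3 x4] hn i hi.
have [/andP[m1 mn] lm _] := history_cs hW hn.
have := history_dt_cs hV hn; rewrite x1 => dV.
have := history_dt_cs hW hn => dW.
have hj : 1 <= n.+1 - i <= n by lia.
have iE : n.+1 - (n.+1 - i) = i by lia.
have := x2 _ hj; have := x3 _ hj; have := x4 _ hj; rewrite iE in_NE in_SdE in_SdE.
have [->|im] := eqVneq i (cs W).
  rewrite dV dW !ltnn /= => -> -> _; split; lia.
have jm : n.+1 - i <> n.+1 - cs W by move/eqP: im; lia.
move=> + + /(_ jm) e; have -> : is_dt (letter V (n.+1 - i)) = ~~ is_dt (letter W i).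
  case: (is_dt (letter V _)) e; case: (is_dt _) => -[e1 e2] //.
    by move: (e2 isT).
  by move: (e1 isT).
move=> -> ->; move: im; case: (is_dt (letter W i)) => /=; rewrite ?andbT ?andbF => im;
  split; rewrite ?im //; do ?case: ifP; lia.
Qed.

(** The top bit comes from clause (2). The bottom bit is forced by the differences of consecutive
    heights; the guard [j < n] reflects that the last letter of a history is never a bottom. *)
Definition xi_letter W (j : nat) : step :=
  mk_step (~~ is_dt (letter W (n.+1 - j)) && (j != n.+1 - cs W))
          ((j < n) && ~~ is_db (letter W (n - j))).

Definition xi_lab W (j : nat) : int :=
  (lab W (n.+1 - j)%N - (is_dt (letter W (n.+1 - j)))%:Z + (n.+1 - j < cs W)%:Z)%R.

Definition xi_word W : n.-tuple step := [tuple xi_letter W i.+1 | i < n].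

Definition xi_triple W : triple n :=
  (xi_word W, [tuple height (xi_word W) i.+1 | i < n], [tuple xi_lab W i.+1 | i < n]).

Lemma letter_xi W j : 1 <= j <= n -> letter (xi_triple W) j = xi_letter W j.
Proof. by case: j => // j hj; rewrite /letter (nth_FV stE (xi_letter W)). Qed.

Lemma ht_xi W j : 1 <= j <= n -> ht (xi_triple W) j = height (xi_word W) j.
Proof. by case: j => // j hj; rewrite /ht (nth_FV 0%R (height (xi_word W))). Qed.

Lemma lab_xi W j : 1 <= j <= n -> lab (xi_triple W) j = xi_lab W j.
Proof. by case: j => // j hj; rewrite /lab (nth_FV 0%R (xi_lab W)). Qed.

Section Xi.
Variables (W : triple n) (hW : is_history W) (n_gt0 : 1 <= n).

(** Induction on [j], which reads [W] backwards from its last letter, whose height equals its top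
    bit. *)
Lemma height_xi_word j : 1 <= j <= n -> height (xi_word W) j =
  (ht W (n.+1 - j)%N - (is_dt (letter W (n.+1 - j)))%:Z + (n.+1 - j < cs W)%:Z)%R.
Proof.
have [m1n lm _] := history_cs hW n_gt0.
case: j => //; elim=> [_|j IH hj].
  rewrite height1 subSS subn0; have := history_htn hW n_gt0.
  by rewrite history_dbn //; lia.
have jn : j < n by lia.
rewrite heightS ?size_tuple // IH ?jn // (nth_FV stE (xi_letter W)) //.
rewrite /xi_letter is_dt_mk is_db_mk !subSS.
have hi : 1 <= n - j.+1 < n by lia.
have := history_htS hW hi; have -> : (n - j.+1).+1 = n - j by lia.
move=> ->; have -> : j.+1 < n by lia.
have -> : (j.+1 != n.+1 - cs W) = (n - j != cs W) by lia.
(* At [cs W] the top bit is not complemented; the indicator of lying below [cs W] jumps exactly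
   there and makes up for it. *)
have [e|] := eqVneq (n - j) (cs W).
  by have := history_dt_cs hW n_gt0; rewrite -e => ->; lia.
by case: (is_dt (letter W (n - j))); case: (is_db _) => /=; lia.
Qed.

(** Letter 1 of [W] has height 0 and so is no top. Hence the last letter of [xi_word W] is a top
    exactly when [cs W] is not 1, which cancels the indicator [1 < cs W]. *)
Lemma height_xi_word_end : height (xi_word W) n.+1 = 0%R.
Proof.
have [m1n lm _] := history_cs hW n_gt0.
have [k nE] : exists k, n = k.+1 by exists n.-1; lia.
have -> : n.+1 = k.+2 by lia.
rewrite heightS ?size_tuple; last by lia.
rewrite -nE height_xi_word ?leqnn ?n_gt0 // (nth_FV stE (xi_letter W)); last by lia.
rewrite /xi_letter is_dt_mk is_db_mk -nE ltnn /=.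
have -> : n.+1 - n = 1 by lia.
have := history_ht1 hW n_gt0; have := @history_lab W hW 1.
by have := history_dt_cs hW n_gt0; case: (is_dt (letter W 1)); lia.
Qed.

(** Heights and labels receive the same correction, which keeps the upper bound. For the lower
    bound, labels of [W] after [cs W] are at least 1, and those before it gain 1. *)
Lemma xi_lab_bounds j : 1 <= j <= n ->
  ((is_dt (xi_letter W j))%:Z <= xi_lab W j <= height (xi_word W) j)%R.
Proof.
move=> hj; have [m1n lm lgt] := history_cs hW n_gt0.
rewrite height_xi_word // /xi_lab /xi_letter is_dt_mk.
have hi : 1 <= n.+1 - j <= n by lia.
have := history_lab hW hi; have := lgt (n.+1 - j).
have -> : (j != n.+1 - cs W) = (n.+1 - j != cs W) by lia.
have [e|] := eqVneq (n.+1 - j) (cs W).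
  by rewrite e lm; have := history_dt_cs hW n_gt0; move=> ->; lia.
by case: (is_dt _); lia.
Qed.

Lemma xi_history : is_history (xi_triple W).
Proof.
apply/and3P; split.
- rewrite /Motzkin2 size_tuple height_xi_word_end eqxx andbT.
  apply/allP => i; rewrite mem_iota => hi.
  have [->|ne] := eqVneq i n.+1; first by rewrite height_xi_word_end.
  have hi' : 1 <= i <= n by lia.
  by have /andP[b1 b2] := xi_lab_bounds hi'; apply: le_trans b2; lia.
- by apply/allP => i; rewrite mem_iota => hi; rewrite ht_xi //; lia.
- apply/allP => i; rewrite mem_iota => hi.
  have hi' : 1 <= i <= n by lia.
  rewrite letter_xi // ht_xi // lab_xi // in_NE; have := xi_lab_bounds hi'.
  by case: (is_dt _).
Qed.

Lemma cs_xi : cs (xi_triple W) = n.+1 - cs W.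
Proof.
have [m1n lm lgt] := history_cs hW n_gt0.
have hm : 1 <= n.+1 - cs W <= n by lia.
have mE : n.+1 - (n.+1 - cs W) = cs W by lia.
apply: cs_unique => //.
  by rewrite lab_xi // /xi_lab mE lm history_dt_cs // ltnn.
move=> j hj; have hj' : 1 <= j <= n by lia.
rewrite lab_xi // /xi_lab; have := @history_lab _ hW (n.+1 - j); lia.
Qed.

Lemma xi_triple_rel : xi_rel W (xi_triple W).
Proof.
have [m1n lm lgt] := history_cs hW n_gt0.
have dtE j : 1 <= j <= n -> is_dt (letter (xi_triple W) j) =
    ~~ is_dt (letter W (n.+1 - j)) && (n.+1 - j != cs W).
  move=> hj; rewrite letter_xi // /xi_letter is_dt_mk; lia.
split; first exact: cs_xi.
- move=> j hj jm; rewrite in_NE in_SdE dtE //; have -> : n.+1 - j != cs W by lia.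
  by rewrite andbT negbK.
- move=> j hj; rewrite ht_xi // height_xi_word // in_SdE in_NE dtE //.
  have [e|] := eqVneq (n.+1 - j) (cs W).
    by rewrite e history_dt_cs //=; do ?case: ifP; lia.
  by case: (is_dt _) => /=; rewrite ?andbT ?andbF; do ?case: ifP; lia.
- by move=> j hj; rewrite ht_xi // lab_xi // height_xi_word // /xi_lab; lia.
Qed.

End Xi.

(** Both bits are complemented twice. The two label corrections cancel: away from [cs W] exactly one
    of [i < cs W] and [cs W < i] holds and exactly one of the two letters is a top, while at [cs W]
    both corrections vanish. *)
Lemma xi_tripleK W : is_history W -> 1 <= n -> xi_triple (xi_triple W) = W.
Proof.
move=> hW hn; have hV := xi_history hW hn.
have [m1n lm lgt] := history_cs hW hn.
have dm := history_dt_cs hW hn.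
have letE i : 1 <= i <= n -> letter (xi_triple (xi_triple W)) i = letter W i.
  move=> hi; rewrite letter_xi // {1}/xi_letter letter_xi; last by lia.
  rewrite {1}/xi_letter is_dt_mk cs_xi //.
  have -> : n.+1 - (n.+1 - i) = i by lia.
  have -> : n.+1 - (n.+1 - cs W) = cs W by lia.
  have -> : (n.+1 - i != n.+1 - cs W) = (i != cs W) by lia.
  rewrite -[RHS]mk_stepK; congr mk_step.
    by have [->|] := eqVneq i (cs W); rewrite ?dm ?andbF ?andbT ?negbK.
  have [->|ne] := eqVneq i n; first by rewrite ltnn history_dbn.
  have -> : i < n by lia.
  rewrite letter_xi; last by lia.
  rewrite is_db_mk; have -> : n - (n - i) = i by lia.
  by rewrite (_ : n - i < n) /= ?negbK; lia.
apply: triple_ext => // i hi.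
- rewrite ht_xi // history_ht //; congr height.
  apply: (@eq_from_nth _ stE); rewrite ?size_tuple // => k hk.
  by have := letE k.+1; rewrite /letter /=; apply; lia.
- rewrite lab_xi // /xi_lab lab_xi; last by lia.
  rewrite letter_xi; last by lia.
  rewrite cs_xi // /xi_letter is_dt_mk /xi_lab.
  have -> : n.+1 - (n.+1 - i) = i by lia.
  have := @history_lab _ hW i hi.
  have [->|] := eqVneq i (cs W); first by rewrite dm eqxx; lia.
  by case: (is_dt _) => /=; lia.
Qed.

(** [xi] is defined by choice, so [xi_triple] serves as a witness that the specification can be met;
    later arguments rely on the specification alone. *)
Lemma xiP : 1 <= n -> is_xi (@xi n).
Proof.
move=> hn; apply: epsilon_spec.
exists (fun W : history n => exist _ (xi_triple (val W)) (xi_history (valP W) hn)).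
split => [W|W]; last exact: xi_triple_rel (valP W) hn.
by apply: val_inj; rewrite /= xi_tripleK // (valP W).
Qed.

End Triples.

(** * Statistics of a permutation and its history *)

Lemma eq_count_iota (P Q : nat -> bool) a m :
  (forall k, a <= k < a + m -> P k = Q k) ->
  count P (iota a m) = count Q (iota a m).
Proof. by move=> PQ; apply: eq_in_count => k; rewrite mem_iota => /PQ. Qed.

(** A discrete intermediate value argument. *)
Lemma count_crossing_gt0 (f : nat -> nat) t a m : t < f a -> f (a + m) <= t ->
  0 < count (fun j => f j.+1 <= t < f j) (iota a m).
Proof.
elim: m a => [|m IH] a; first by rewrite addn0; lia.
rewrite addnS -addSn => fa fm /=; rewrite fa andbT.
by case: (leqP (f a.+1) t) => //= h; apply: IH.
Qed.

(** Telescoping: up and down crossings of [i] are the changes of the truth value of [i < f j]. *)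
Lemma count_up_down (f : nat -> nat) i a m :
  (forall j, a <= j <= a + m -> f j != i) ->
  count (fun j => f j < i < f j.+1) (iota a m) + (i < f a) =
  count (fun j => f j.+1 < i < f j) (iota a m) + (i < f (a + m)).
Proof.
elim: m a => [|m IH] a ne /=; first by rewrite addn0.
have {}/IH : forall j, a.+1 <= j <= a.+1 + m -> f j != i.
  by move=> j hj; apply: ne; lia.
by rewrite addSnnS; have := ne a; have := ne a.+1; lia.
Qed.

Section Stats.
Variables (n : nat) (pi : 'S_n).
Local Notation pos := (ol pi^-1).

Definition left_cross i :=
  count (fun j => ol pi j.+1 < i < ol pi j) (index_iota 1 (pos i).-1).

(** The threshold lies between [t] and [t.+1], unlike the strict straddling in [left_cross]. Being
    monotone in [p], this count can compare positions. *)
Definition down_cross t p :=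
  count (fun j => ol pi j.+1 <= t < ol pi j) (iota 0 p).

Lemma pos_bound i : 1 <= i <= n -> 1 <= pos i <= n.
Proof. exact: ol_bound. Qed.

Lemma ol_inj_pos i k : 1 <= i <= n -> k <= n.+1 -> (ol pi k == i) = (k == pos i).
Proof.
move=> hi hk; have [->|ne] := eqVneq k (pos i); first by rewrite olVK // eqxx.
by apply/negbTE/ol_ext_neq.
Qed.

Lemma pos_inj i j : 1 <= i <= n -> 1 <= j <= n -> pos i = pos j -> i = j.
Proof. by move=> hi hj e; rewrite -(olVK pi hi) e olVK. Qed.

Lemma is_dt_FV i : 1 <= i <= n ->
  is_dt (FV_letter pi i) = (ol pi (pos i).+1 < i).
Proof.
move=> hi; have := @ol_ext_neq n pi i (pos i).+1 hi.
have := pos_bound hi; rewrite /FV_letter olVK //.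
by case: (ol pi (pos i).-1 < i); case: (ltnP i _) => /=; lia.
Qed.

Lemma is_db_FV i : 1 <= i <= n ->
  is_db (FV_letter pi i) = (i < ol pi (pos i).-1).
Proof.
move=> hi; have := @ol_ext_neq n pi i (pos i).-1 hi.
have := pos_bound hi; rewrite /FV_letter olVK //.
by case: (i < ol pi (pos i).+1); case: (ltnP _ i) => /=; lia.
Qed.

Lemma left_crossE i :
  left_cross i = count (fun j => ol pi j.+1 < i < ol pi j) (iota 0 (pos i).-1).
Proof.
rewrite /left_cross; case: (pos i).-1 => // k.
by rewrite /index_iota subSS subn0 /= ltn0 andbF.
Qed.

Lemma FV_labE i : 1 <= i <= n -> FV_lab pi i =
  Posz (count (fun j => ol pi j.+1 < i < ol pi j) (index_iota (pos i).+1 n)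
        + is_dt (FV_letter pi i)).
Proof. by move=> hi; rewrite /FV_lab olVK // in_SdE. Qed.

(** The height counts the descents from at least [i] to below [i]. Those straddling [i] lie left or
    right of it; the only other candidate is the step leaving [i], which supplies the top bit of the
    label. *)
Lemma height_FV_split i : 1 <= i <= n ->
  height (FV_word pi) i = (FV_lab pi i + (left_cross i)%:Z)%R.
Proof.
move=> hi; rewrite FV_height; last by lia.
rewrite FV_labE // is_dt_FV // left_crossE.
have hp := pos_bound hi; have pi_p := olVK pi hi.
have ne := @ol_ext_neq n pi i ^~ hi.
move: (pos i) hp pi_p ne => p hp pi_p ne.
have -> : n.+1 = p.-1 + (2 + (n - p)) by lia.
rewrite iotaD count_cat add0n /= prednK; last by lia.
rewrite pi_p ltnn leqnn andbT add0n /index_iota.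
rewrite (@eq_count_iota _ (fun j => ol pi j.+1 < i < ol pi j) 0 p.-1); last first.
  by move=> k hk; have := ne k; lia.
have [->|pn] := eqVneq p n.
  by rewrite subnn (_ : n - n.+1 = 0) /= ?ol_out; lia.
have -> : n - p = (n - p.+1) + 1 by lia.
rewrite iotaD count_cat /= (_ : p.+1 + (n - p.+1) = n) ?ol_out; last by lia.
rewrite (@eq_count_iota _ (fun j => ol pi j.+1 < i < ol pi j) p.+1); last first.
  by move=> k hk; have := ne k; lia.
lia.
Qed.

(** The step landing on [i] counts here but does not straddle [i]; it is a descent exactly when [i]
    is a bottom. *)
Lemma down_cross_self i : 1 <= i <= n ->
  down_cross i (pos i) = left_cross i + is_db (FV_letter pi i).
Proof.
move=> hi; rewrite is_db_FV // left_crossE /down_cross.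
have hp := pos_bound hi; have pi_p := olVK pi hi.
have ne := @ol_ext_neq n pi i ^~ hi.
move: (pos i) hp pi_p ne => p hp pi_p ne.
have {1}-> : p = p.-1 + 1 by lia.
rewrite iotaD count_cat /= add0n prednK ?pi_p; last by lia.
rewrite leqnn addn0; congr addn.
by apply: eq_count_iota => k hk; have := ne k.+1; lia.
Qed.

(** The step landing on [t.+1] ends above the threshold, so only straddling descents remain. *)
Lemma down_cross_next t : t < n -> down_cross t (pos t.+1) = left_cross t.+1.
Proof.
move=> ht; have hi : 1 <= t.+1 <= n by lia.
rewrite left_crossE /down_cross.
have hp := pos_bound hi; have pi_p := olVK pi hi.
have ne := @ol_ext_neq n pi t.+1 ^~ hi.
move: (pos t.+1) hp pi_p ne => p hp pi_p ne.
have {1}-> : p = p.-1 + 1 by lia.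
rewrite iotaD count_cat /= add0n prednK ?pi_p; last by lia.
rewrite ltnn !addn0.
by apply: eq_count_iota => k hk; have := ne k; lia.
Qed.

(* The word drops from above t to at most t somewhere between the position of
   t + 1 and a later position of i <= t. *)
Lemma pos_ltE i t : 1 <= i <= t -> t < n ->
  (pos t.+1 < pos i) = (down_cross t (pos t.+1) < down_cross t (pos i)).
Proof.
move=> hi ht.
have h1 : 1 <= i <= n by lia.
have h2 : 1 <= t.+1 <= n by lia.
have := olVK pi h1; have := olVK pi h2; rewrite /down_cross.
move: (pos i) (pos t.+1) => p q eq ep; case: ltnP => pq.
  have -> : p = q + (p - q) by lia.
  rewrite iotaD count_cat add0n.
  have := @count_crossing_gt0 (ol pi) t q (p - q).
  rewrite eq (_ : q + (p - q) = p) ?ep; last by lia.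
  by move/(_ (leqnn _)); lia.
have -> : q = p + (q - p) by lia.
by rewrite iotaD count_cat; lia.
Qed.

Lemma IdesE i : 1 <= i < n -> (pos i.+1 < pos i) =
  (left_cross i.+1 < left_cross i + is_db (FV_letter pi i)).
Proof.
by move=> hi; rewrite pos_ltE ?leqnn ?down_cross_next ?down_cross_self //; lia.
Qed.

(** Raising the threshold affects only the two steps at [t.+1]: the one entering it starts to count
    if it is a descent, the one leaving it ceases to. Both precede [i] exactly when [t.+1] does. *)
Lemma down_crossS i t : 1 <= i <= t -> t < n ->
  down_cross t.+1 (pos i) + (pos t.+1 < pos i) * is_dt (FV_letter pi t.+1) =
  down_cross t (pos i) + (pos t.+1 < pos i) * is_db (FV_letter pi t.+1).
Proof.
move=> hi ht.
have h1 : 1 <= i <= n by lia.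
have h2 : 1 <= t.+1 <= n by lia.
have ip : pos i != pos t.+1 by apply/eqP => /(pos_inj h1 h2); lia.
rewrite is_dt_FV // is_db_FV // /down_cross.
have := olVK pi h2; have := @ol_ext_neq n pi t.+1 ^~ h2.
have := pos_bound h1; have := pos_bound h2.
move: (pos i) (pos t.+1) ip => p q pq hq hp ne eq; case: ltnP => qp; last first.
  rewrite !mul0n !addn0; apply: eq_count_iota => k hk.
  by have := ne k; have := ne k.+1; lia.
have -> : p = q.-1 + (2 + (p - q.+1)) by lia.
rewrite iotaD !count_cat add0n /= prednK ?eq; last by lia.
rewrite !ltnn !leqnn !mul1n.
rewrite (@eq_count_iota _ (fun j => ol pi j.+1 <= t < ol pi j) 0 q.-1); last first.
  by move=> k hk; have := ne k; have := ne k.+1; lia.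
rewrite (@eq_count_iota _ (fun j => ol pi j.+1 <= t < ol pi j) q.+1); last first.
  by move=> k hk; have := ne k; have := ne k.+1; lia.
lia.
Qed.

(** Up and down crossings of [i] to its right differ according to whether the walk starts and ends
    above [i]; it starts above exactly when [i] is not a top. If [i] is last, no steps remain. *)
Lemma count_213 i : 1 <= i <= n ->
  Posz (count (fun j => ol pi j < i < ol pi j.+1) (index_iota (pos i).+1 n)) =
  if i == ol pi n then 0%R else (FV_lab pi i - 1 + (i < ol pi n)%:Z)%R.
Proof.
move=> hi; rewrite FV_labE // is_dt_FV // eq_sym ol_inj_pos //.
have hp := pos_bound hi; have ne := @ol_ext_neq n pi i ^~ hi.
move: (pos i) hp ne => p hp ne; rewrite eq_sym /index_iota.
have [->|pn] := eqVneq p n; first by rewrite (_ : n - n.+1 = 0) //; lia.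
have := @count_up_down (ol pi) i p.+1 (n - p.+1).
have -> : p.+1 + (n - p.+1) = n by lia.
have ne' j : p.+1 <= j <= n -> ol pi j != i by move=> hj; apply: ne; lia.
move=> /(_ ne').
by have := ne p.+1; have := ne n; lia.
Qed.

Lemma letter_FV i : 1 <= i <= n -> letter (FV_triple pi) i = FV_letter pi i.
Proof. by case: i => // i hi; rewrite /letter (nth_FV stE (FV_letter pi)). Qed.

Lemma lab_FV i : 1 <= i <= n -> lab (FV_triple pi) i = FV_lab pi i.
Proof. by case: i => // i hi; rewrite /lab (nth_FV 0%R (FV_lab pi)). Qed.

Lemma ht_FV i : 1 <= i <= n ->
  ht (FV_triple pi) i = (FV_lab pi i + (left_cross i)%:Z)%R.
Proof.
move=> hi; rewrite -height_FV_split // history_ht //; exact: FV_history.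
Qed.

(** Nothing follows the last value, so its label is 0. A larger value is either a top, with label at
    least 1, or is followed by a rise, after which the word must drop across it to reach the last
    value. *)
Lemma cs_FV : 1 <= n -> cs (FV_triple pi) = ol pi n.
Proof.
move=> hn; have hm : 1 <= ol pi n <= n by apply: ol_bound; lia.
have pos_m : pos (ol pi n) = n by apply: olK; lia.
apply: cs_unique => //.
  rewrite lab_FV // FV_labE // is_dt_FV // pos_m ol_out /index_iota.
  by rewrite (_ : n - n.+1 = 0) //=; lia.
move=> i /andP[mi ni]; have hi : 1 <= i <= n by lia.
rewrite lab_FV // FV_labE // is_dt_FV //.
have ne := @ol_ext_neq n pi i ^~ hi; have hp := pos_bound hi.
have pn : pos i != n by apply/eqP => e; move: (olVK pi hi); rewrite e; lia.
move: (pos i) hp ne pn => p hp ne pn; rewrite /index_iota.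
case: (ltnP (ol pi p.+1) i) => dt; first by lia.
have := @count_crossing_gt0 (ol pi) i.-1 p.+1 (n - p.+1).
have -> : p.+1 + (n - p.+1) = n by lia.
move=> /(_ ltac:(lia)) /(_ ltac:(lia)).
rewrite (@eq_count_iota _ (fun j => ol pi j.+1 < i < ol pi j)); first by lia.
by move=> k hk; have := ne k; have := ne k.+1; lia.
Qed.

End Stats.

(** * Surjectivity of Phi_FV by insertion *)

Definition seq_cross i a u := count id (pairmap (fun x y => y < i < x) a u).

Lemma seq_cross_cat i a u v :
  seq_cross i a (u ++ v) = seq_cross i a u + seq_cross i (last a u) v.
Proof. by rewrite /seq_cross pairmap_cat count_cat. Qed.

Lemma seq_cross_cons i a b u :
  seq_cross i a (b :: u) = (b < i < a) + seq_cross i b u.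
Proof. by []. Qed.

Lemma seq_cross_high i a u : all (ltn i) u -> seq_cross i a u = 0.
Proof.
rewrite /seq_cross; elim: u a => //= x u IH a /andP[ix /IH->].
by rewrite ltnNge (ltnW ix).
Qed.

Lemma seq_cross_start i a b u : i < a -> i < b -> seq_cross i a u = seq_cross i b u.
Proof. by rewrite /seq_cross; case: u => //= x u -> ->. Qed.

Lemma seq_cross_nth i a u : seq_cross i a u =
  count (fun j => nth 0 (a :: u) j.+1 < i < nth 0 (a :: u) j) (iota 0 (size u)).
Proof.
rewrite /seq_cross; elim: u a => //= x u IH a.
by rewrite IH -[1]/(1 + 0) iotaDl count_map.
Qed.

(** Used to select a slot by the number of slots to its left. *)
Lemma split_nth_occurrence (T : eqType) (z : T) s l : l < count_mem z s ->
  exists u v, s = u ++ z :: v /\ count_mem z u = l.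
Proof.
elim: s l => //= x s IH l; have [->|xz] := eqVneq x z; last first.
  by move=> /IH[u [v [-> <-]]]; exists (x :: u), v; rewrite /= (negPf xz).
case: l => [_|l]; first by exists [::], s.
by rewrite add1n ltnS => /IH[u [v [-> <-]]]; exists (z :: u), v; rewrite /= eqxx.
Qed.

Lemma cat_cons_eq (T : Type) (a b : T) u v u1 v1 : a <> b ->
  u ++ a :: v = u1 ++ b :: v1 ->
  (exists u2, u1 = u ++ a :: u2 /\ v = u2 ++ b :: v1) \/
  (exists u2, u = u1 ++ b :: u2 /\ v1 = u2 ++ a :: v).
Proof.
move=> ab; elim: u u1 => [|x u IH] [|y u1] //=.
- by case=> /ab.
- by case=> <- ->; left; exists u1.
- by case=> -> <-; right; exists u.
by case=> <- /IH[[u2 [-> ->]]|[u2 [-> ->]]]; [left | right]; exists u2.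
Qed.

(** * Partial words with slots *)

Section Insertion.
Variables (n : nat) (L : nat -> step) (l : nat -> nat).

(* In a partial word the letter n.+1 marks a slot, to be filled by larger values. *)
Definition no_double_slot := fun a b => ~~ ((a == n.+1) && (b == n.+1)).

(** The defaults 0 and [n.+1] match the conventions of [ol]. A slot counts as a large neighbour, so
    the data of [i] survive when slots are filled by larger values. *)
Definition decodes t (s : seq nat) := forall i, 1 <= i <= t ->
  exists u v : seq nat, [/\ s = u ++ i :: v, (i < last 0 u) = is_db (L i),
    (head n.+1 v < i) = is_dt (L i) & seq_cross i 0 u = l i].

(** What replaces a slot in the insertion procedure of Françon and Viennot: a slot is left on each
    side where the neighbour of [t] has to be larger. *)
Definition insertion t :=
  ((if is_db (L t) then [:: n.+1] else [::]) ++
   t :: (if is_dt (L t) then [::] else [:: n.+1])).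

(** No slot is followed by another, so each slot starts exactly one descent straddling [t.+1]; the
    appended [n.+1] keeps the last letter of [a :: u] from being a slot. *)
Lemma seq_cross_slots t a u :
  (forall x : nat, x \in a :: u -> x <= t \/ x = n.+1) -> t < n ->
  path no_double_slot a (rcons u n.+1) ->
  seq_cross t.+1 a u = count_mem n.+1 (a :: u).
Proof.
move=> + tn; rewrite /seq_cross; elim: u a => [|x u IH] a Hu.
  by rewrite /= andbT /no_double_slot eqxx andbT => /negPf->.
rewrite rcons_cons [path _ _ _]/= => /andP[ax px] /=.
rewrite (IH x) //; last first.
  by move=> y hy; apply: Hu; rewrite inE hy orbT.
have := Hu a (mem_head _ _); have := Hu x; rewrite !inE eqxx orbT => /(_ isT).
by move: ax; rewrite /no_double_slot /=; lia.
Qed.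

Lemma decodes_insert t (u v : seq nat) : t < n ->
  decodes t (u ++ n.+1 :: v) -> decodes t (u ++ insertion t.+1 ++ v).
Proof.
move=> tn D i hi; have [u1 [v1 [e e1 e2 e3]]] := D i hi.
have ix : all (ltn i) (insertion t.+1).
  by rewrite /insertion all_cat /=; do 2![case: ifP => _ /=]; lia.
have [y [z xE]] : exists y z, insertion t.+1 = y :: z.
  by rewrite /insertion; case: is_db; do 2!eexists.
have lastx b : i < last b (insertion t.+1).
  have /allP h := ix; apply: h; rewrite xE /=; exact: mem_last.
have hd : i < y by move: ix; rewrite xE /= => /andP[].
move: (insertion t.+1) ix xE lastx => x ix xE lastx.
have ni : n.+1 <> i by lia.
(* The filled slot lies either left or right of [i]. *)
case: (cat_cons_eq ni e) => -[u2 [uE vE]].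
  exists (u ++ x ++ u2), v1; split => //.
  - by rewrite vE -!catA.
  - rewrite -e1 uE !last_cat /=; case: (u2) => [|? ?] //=; rewrite lastx; lia.
  - rewrite -e3 uE !seq_cross_cat (seq_cross_high _ ix) add0n; congr addn.
    rewrite [RHS]seq_cross_cons (_ : n.+1 < i = false); last by lia.
    by rewrite add0n; apply: seq_cross_start => //; lia.
exists u1, (u2 ++ x ++ v); split => //; first by rewrite uE -!catA.
by rewrite -e2 vE xE; case: (u2) => //=; lia.
Qed.

(** The last letter is kept a slot, so that for [t = n] and [k = 1] it becomes the sentinel at
    position [n.+1]. *)
Definition partial_perm t k (s : seq nat) :=
  [/\ perm_eq s (iota 1 t ++ nseq k n.+1), last 0 s = n.+1,
      path no_double_slot 0 s & decodes t s].

Lemma partial_perm_insert t k (s : seq nat) : t < n -> partial_perm t k s ->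
  l t.+1 + is_dt (L t.+1) < k ->
  exists s', partial_perm t.+1 (k + is_db (L t.+1) - is_dt (L t.+1)) s'.
Proof.
move=> tn [sP slast spath sdec] lk.
have ms (x : nat) : x \in s -> x <= t \/ x = n.+1.
  rewrite (perm_mem sP) mem_cat mem_iota => /orP[|/nseqP[]]; last by right.
  by left; lia.
have cs : count_mem n.+1 s = k.
  rewrite (seq.permP sP) count_cat count_nseq /= eqxx mul1n (count_memPn _) //.
  by rewrite mem_iota; lia.
have lk' : l t.+1 < count_mem n.+1 s by lia.
have [u [v [sE cu]]] : exists u v : seq nat,
  s = u ++ n.+1 :: v /\ count_mem n.+1 u = l t.+1 := split_nth_occurrence lk'.
exists (u ++ insertion t.+1 ++ v).
have cv : count_mem n.+1 v = k - (l t.+1).+1.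
  by rewrite -cs sE count_cat /= eqxx cu; lia.
(* A top leaves no slot on its right, so it may not use the final slot; this is what [is_dt] in the
   bound on [l] guarantees. *)
have vnil : is_dt (L t.+1) -> v <> [::] by move=> d v0; rewrite v0 d /= in cv lk; lia.
move: spath; rewrite sE cat_path [path _ _ (_ :: _)]/= => /and3P[pu pl pv].
have mu (x : nat) : x \in 0 :: u -> x <= t \/ x = n.+1.
  by rewrite inE => /predU1P[-> //|xu]; [left | apply: ms; rewrite sE mem_cat xu].
have mv (x : nat) : x \in v -> x <= t \/ x = n.+1.
  by move=> xv; apply: ms; rewrite sE mem_cat inE xv !orbT.
have lu : last 0 u <= t.
  move: pl; rewrite /no_double_slot eqxx andbT => /eqP ne.
  by case: (mu _ (mem_last 0 u)) => // /ne.
have hv : v <> [::] -> head n.+1 v <= t.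
  case: (v) mv pv => // x v' mv' /= /andP[+ _] _.
  by rewrite /no_double_slot eqxx => /eqP ne; case: (mv' x (mem_head _ _)) => // /ne.
split.
- apply/seq.permP => P; have := seq.permP sP P.
  have -> : iota 1 t.+1 = iota 1 t ++ [:: t.+1] by have := iotaD 1 t 1; rewrite addn1.
  rewrite sE !count_cat /= !count_nseq /=; move: lk.
  by case: (is_db _); case: (is_dt _) => /=; case: (P n.+1) => /=; lia.
- move: slast; rewrite sE !last_cat /=; case: (v) vnil => //= + _.
  by case: (is_dt _) => //= /(_ isT).
- rewrite /insertion !cat_path pu.
  have t1 a : (no_double_slot a t.+1) by rewrite /no_double_slot; lia.
  have t2 a : (no_double_slot t.+1 a) by rewrite /no_double_slot; lia.
  have pvt : path no_double_slot t.+1 v.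
    by case: (v) pv => //= x v' /andP[_ ->]; rewrite t2.
  by case: (is_db _); case: (is_dt _); rewrite /= ?t1 ?t2 ?pv ?pvt ?pl.
- move=> i /andP[i1 it]; have [ilt|ieq] : i <= t \/ i = t.+1 by lia.
    by apply: (decodes_insert tn); rewrite -?sE //; lia.
  rewrite ieq; exists (u ++ (if is_db (L t.+1) then [:: n.+1] else [::])),
    ((if is_dt (L t.+1) then [::] else [:: n.+1]) ++ v); split.
  + by rewrite /insertion -!catA.
  + by rewrite last_cat; case: (is_db _) => /=; lia.
  + case: (is_dt _) vnil => /= [/(_ isT)/hv|_]; lia.
  (* The slots in [u] account for [l t.+1] descents; a new slot just before [t.+1] adds none. *)
  + rewrite seq_cross_cat seq_cross_slots //; first last.
      by rewrite rcons_path pu.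
    rewrite -cu /= seq_cross_high ?addn0 //.
    by case: (is_db _); rewrite //= andbT; lia.
Qed.

End Insertion.

Lemma perm_of_oneline n (s : seq nat) : perm_eq s (iota 1 n) ->
  exists pi : 'S_n, forall k, k < n -> ol pi k.+1 = nth 0 s k.
Proof.
move=> sP; have sz : size s = n by rewrite (perm_size sP) size_iota.
have us : uniq s by rewrite (perm_uniq sP) iota_uniq.
have sb k : k < n -> 1 <= nth 0 s k <= n.
  move=> hk; have : nth 0 s k \in s by rewrite mem_nth ?sz.
  by rewrite (perm_mem sP) mem_iota; lia.
pose f (k : 'I_n) : 'I_n := insubd k (nth 0 s k).-1.
have fE (k : 'I_n) : f k = (nth 0 s k).-1 :> nat.
  by rewrite /f insubdK //; have := sb k (ltn_ord k); rewrite /in_mem /=; lia.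
have f_inj : injective f.
  move=> i j /(congr1 val) /=; rewrite !fE => e; apply/val_inj/eqP => /=.
  have eij : nth 0 s i = nth 0 s j.
    by have := sb i (ltn_ord i); have := sb j (ltn_ord j); lia.
  by rewrite -(nth_uniq 0 _ _ us) ?sz // eij.
exists (perm f_inj) => k hk; rewrite ol_in permE fE /=.
by have := sb k hk; lia.
Qed.

Lemma FV_surj n (W : history n) : exists pi : 'S_n, Phi_FV pi = W.
Proof.
case: W => W hW; set w := W.1.1.
pose L := letter W; pose l i := `|ht W i - lab W i|%N.
have htE i : 1 <= i <= n -> ht W i = height w i by apply: history_ht.
have labE i := @history_lab n _ hW i.
have [s [sP slast _ sdec]] : exists s, partial_perm n L l n 1 s.
  have hend : height w n.+1 = 0%R.
    by case/and3P: hW => /andP[_ /eqP]; rewrite size_tuple.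
  (* There is one slot more than the height, the extra one being the permanent final slot. *)
  suff /(_ n (leqnn n)) : forall t, t <= n ->
      exists s k, partial_perm n L l t k s /\ Posz k = (height w t.+1 + 1)%R.
    by rewrite hend => -[s [k [H kE]]]; exists s; have <- : k = 1 by lia.
  elim=> [_|t IH tn].
    exists [:: n.+1], 1; rewrite height1; split => //; split => //.
    by move=> i; lia.
  have [s [k [H kE]]] := IH (ltnW tn).
  have hi : 1 <= t.+1 <= n by lia.
  have hl := labE t.+1 hi; rewrite htE // in hl.
  (* The label is at least the top bit, so [l] plus that bit is at most the height, which is below
     [k]. *)
  have [|s' H'] := @partial_perm_insert n L l t k s tn H.
    by rewrite /l htE // /L; lia.
  exists s'; eexists; split; first exact: H'.
  have e : L t.+1 = nth stE w t by [].
  by rewrite heightS ?size_tuple // -e; move: hl; rewrite -[letter _ _]/(L _); lia.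
have szs : size s = n.+1 by rewrite (perm_size sP) size_cat size_iota size_nseq addn1.
have [s' sE] : exists s', s = rcons s' n.+1.
  by case/lastP: s slast szs {sP sdec} => // s' x; rewrite last_rcons => -> _; exists s'.
have szs' : size s' = n by move: szs; rewrite sE size_rcons => -[].
have [pi piE] : exists pi : 'S_n, forall k, k < n -> ol pi k.+1 = nth 0 s' k.
  apply: perm_of_oneline; rewrite -(perm_cat2r [:: n.+1]) cats1 -sE.
  exact: sP.
have olE k : k <= n.+1 -> ol pi k = nth 0 (0 :: s) k.
  case: k => // k hk; rewrite /= sE nth_rcons szs'.
  have [kn|] := ltnP k n; first by rewrite piE.
  by move=> nk; rewrite (_ : k = n) ?eqxx ?ol_out //; lia.
have dec i : 1 <= i <= n -> FV_letter pi i = L i /\ left_cross pi i = l i.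
  move=> hi; have [u [v [suv e1 e2 e3]]] := sdec i hi.
  have szuv : size u + (size v).+1 = n.+1 by rewrite -szs suv size_cat.
  have vnil : v <> [::].
    by move=> v0; move: slast; rewrite suv v0 last_cat /=; lia.
  have posE : ol pi^-1 i = (size u).+1.
    apply/esym/eqP; rewrite -ol_inj_pos //; last by lia.
    by rewrite olE /= ?suv ?nth_cat ?ltnn ?subnn //; lia.
  have nthu k : k <= size u -> ol pi k = nth 0 (0 :: u) k.
    by move=> hk; rewrite olE ?suv -?cat_cons ?nth_cat ?ltnS ?hk //; lia.
  have uE : ol pi (size u) = last 0 u by rewrite nthu // (last_nth 0).
  have vE : ol pi (size u).+2 = head n.+1 v.
    rewrite olE /=; last by case: (v) vnil szuv => //= *; lia.
    by rewrite suv nth_cat ltnNge leqnSn /= subSnn /=; case: (v) vnil.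
  split; last first.
    rewrite left_crossE posE -e3 seq_cross_nth; apply: eq_count_iota => k hk.
    by rewrite !nthu //; lia.
  rewrite -[LHS]mk_stepK -[RHS]mk_stepK is_dt_FV // is_db_FV // posE uE vE.
  by rewrite e1 e2.
exists pi; apply: val_inj => /=.
have wE : FV_word pi = w.
  apply/val_inj/(@eq_from_nth _ stE); rewrite ?size_tuple // => k hk.
  by rewrite (nth_FV stE (FV_letter pi)) // (dec k.+1 _).1.
have hE i : 1 <= i <= n -> ht (FV_triple pi) i = ht W i.
  by move=> hi; rewrite (history_ht (FV_history pi)) // htE // [_.1.1]/= wE.
apply: triple_ext => // i hi; first by rewrite letter_FV // (dec i hi).1.
have := hE i hi; rewrite ht_FV // lab_FV // (dec i hi).2 /l.
by have := labE i hi; lia.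
Qed.

(** * Injectivity of Phi_FV *)

(** Each value is recovered as the number of smaller values. *)
Lemma perm_order_inj n (s t : 'S_n) :
  (forall i j : 'I_n, (s i < s j) = (t i < t j)) -> s = t.
Proof.
have rankE (u : 'S_n) (i : 'I_n) : #|[set j | u j < u i]| = u i.
  have -> : [set j | u j < u i] = u @^-1: [set k : 'I_n | k < u i].
    by apply/setP => j; rewrite !inE.
  rewrite card_preimset; last exact: perm_inj.
  rewrite -sum1_card -[RHS]card_ord -[RHS]sum1_card.
  rewrite (big_ord_widen n (fun=> 1) (ltnW (ltn_ord (u i)))).
  by apply: eq_bigl => k; rewrite inE.
move=> st; apply/permP => i; apply/val_inj; rewrite /= -[LHS]rankE -[RHS]rankE.
by congr #|pred_of_set _|; apply/setP => j; rewrite !inE st.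
Qed.

Lemma FV_inj n (pi sg : 'S_n) : FV_triple pi = FV_triple sg -> pi = sg.
Proof.
move=> e.
have letE i : 1 <= i <= n -> FV_letter pi i = FV_letter sg i.
  by move=> hi; rewrite -!letter_FV // e.
have lcE i : 1 <= i <= n -> left_cross pi i = left_cross sg i.
  by move=> hi; have := ht_FV pi hi; rewrite -lab_FV // e ht_FV // lab_FV //; lia.
(* The order of the values up to [t] is rebuilt together with their [down_cross]: the latter places
   [t.+1] by [pos_ltE], and the new order updates it by [down_crossS]. *)
suff H t : t <= n ->
    (forall i, 1 <= i <= t ->
       down_cross pi t (ol pi^-1 i) = down_cross sg t (ol sg^-1 i)) /\
    (forall i j, 1 <= i <= t -> 1 <= j <= t ->
       (ol pi^-1 i < ol pi^-1 j) = (ol sg^-1 i < ol sg^-1 j)).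
  apply/invg_inj/perm_order_inj => i j; have := (H n (leqnn n)).2 i.+1 j.+1.
  have ordE (k : 'I_n) : Ordinal (ltn_ord k) = k by apply: val_inj.
  rewrite !(ol_in _ (ltn_ord i)) !(ol_in _ (ltn_ord j)) !ordE !ltnS.
  by apply; rewrite ltn_ord.
elim: t => [_|t IH tn]; first by split=> [i|i j]; lia.
have [IH1 IH2] := IH (ltnW tn).
have hi : 1 <= t.+1 <= n by lia.
have lastE i : 1 <= i <= t ->
    (ol pi^-1 t.+1 < ol pi^-1 i) = (ol sg^-1 t.+1 < ol sg^-1 i).
  by move=> it; rewrite !pos_ltE // !down_cross_next // lcE // IH1.
split=> [i it|i j it jt].
  have [->|ne] := eqVneq i t.+1; first by rewrite !down_cross_self // lcE // letE.
  have it' : 1 <= i <= t by lia.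
  have := down_crossS pi it' tn; have := down_crossS sg it' tn.
  rewrite lastE // IH1 // letE //.
  by case: (ol sg^-1 t.+1 < _); rewrite ?mul0n ?mul1n; lia.
have [->|ni] := eqVneq i t.+1; have [->|nj] := eqVneq j t.+1.
- by rewrite !ltnn.
- by apply: lastE; lia.
- have it' : 1 <= i <= t by lia.
  have np (s : 'S_n) : ol s^-1 i != ol s^-1 t.+1.
    by apply/eqP => /(pos_inj (i := i)) e0; have := e0 ltac:(lia) hi; lia.
  by have := lastE i it'; have := np pi; have := np sg; lia.
- by apply: IH2; lia.
Qed.

(** * Sets and multisets under complementation *)

Local Open Scope mset_scope.
Local Open Scope fset_scope.

Lemma in_kappa N (A : {fset nat}) x : (forall y, y \in A -> 1 <= y < N) ->
  (x \in kappa N A) = (1 <= x < N) && (N - x \in A).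
Proof.
move=> AN; apply/imfsetP/andP => /= [[y yA ->]|[hx xA]].
  have := AN y yA => hy; have -> : N - (N - y) = y by lia.
  by split => //; lia.
by exists (N - x) => //; lia.
Qed.

Lemma mkappaE N (A : {mset nat}) x : (forall y, y \in A -> 1 <= y < N) ->
  mkappa N A x = if 1 <= x < N then A (N - x) else 0.
Proof.
move=> AN; rewrite /mkappa mset_seqE count_map; case: ifP => hx.
  rewrite -count_mem_mset; apply: eq_in_count => y yA /=.
  by have := AN y yA; lia.
rewrite (@eq_in_count _ _ pred0) ?count_pred0 // => y yA /=.
by have := AN y yA; lia.
Qed.

(** * The statistics in terms of letters and crossing counts *)

Section StatMembership.
Variables (n : nat) (pi : 'S_n).
Local Notation pos := (ol pi^-1).

Lemma in_Dt x : (x \in Dt pi) = (1 <= x <= n) && is_dt (FV_letter pi x).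
Proof.
apply/imfsetP/andP => /= [[i]|[hx]].
  rewrite !inE mem_iota => /andP[hi di] ->.
  have hn : 1 <= i <= n by lia.
  by rewrite is_dt_FV ?ol_bound ?olK.
rewrite is_dt_FV // => dx; exists (pos x); rewrite ?olVK //.
have hp := pos_bound pi hx; rewrite !inE mem_iota olVK // dx andbT.
have : pos x != n by apply/eqP => e; move: dx; rewrite e ol_out; lia.
by lia.
Qed.

Lemma in_Db x : (x \in Db pi) = (1 <= x <= n) && is_db (FV_letter pi x).
Proof.
apply/imfsetP/andP => /= [[i]|[hx]].
  rewrite !inE mem_iota => /andP[hi di] ->.
  have hn : 1 <= i.+1 <= n by lia.
  by rewrite is_db_FV ?ol_bound ?olK.
rewrite is_db_FV // => dx; exists (pos x).-1; have hp := pos_bound pi hx.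
  rewrite !inE mem_iota prednK ?olVK // ?dx ?andbT; last by lia.
  have : (pos x).-1 != 0 by apply/eqP => e; move: dx; rewrite e /ol ltn0.
  by lia.
by rewrite prednK ?olVK //; lia.
Qed.

(** The last value is followed by the sentinel [n.+1], so it is a non-top without being an ascent
    bottom. *)
Lemma in_Ab x : (x \in Ab pi) =
  [&& 1 <= x <= n, ~~ is_dt (FV_letter pi x) & x != ol pi n].
Proof.
apply/imfsetP/and3P => /= [[i]|[hx]].
  rewrite !inE mem_iota => /andP[hi di] ->.
  have hn : 1 <= i <= n by lia.
  rewrite is_dt_FV ?ol_bound ?olK //; split=> //; first by lia.
  by rewrite eq_sym ol_inj_pos ?olK ?ol_bound //; lia.
rewrite is_dt_FV // => dx xn; exists (pos x); rewrite ?olVK //.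
have hp := pos_bound pi hx; rewrite !inE mem_iota olVK //.
rewrite eq_sym ol_inj_pos // in xn.
by have := @ol_ext_neq n pi x (pos x).+1 hx; lia.
Qed.

Lemma in_Ides x : (x \in Ides pi) =
  (1 <= x < n) && (left_cross pi x.+1 < left_cross pi x + is_db (FV_letter pi x)).
Proof.
rewrite !inE mem_iota; case hx: (1 <= x < n); first by rewrite -IdesE //; lia.
by apply/andP => -[]; lia.
Qed.

Lemma mset_of_multE f x :
  mset_of_mult pi f x = if 1 <= x <= n then f (pos x) else 0.
Proof.
rewrite /mset_of_mult mset_seqE count_flatten -map_comp sumnE big_map.
under eq_bigr => i _ do rewrite /= count_nseq /=.
case: ifP => hx; last first.
  rewrite big_seq big1 // => i; rewrite mem_iota => hi.
  have hn : 1 <= i <= n by lia.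
  have := ol_bound pi hn; case: eqP; lia.
have hp := pos_bound pi hx.
have mp : pos x \in iota 1 n by rewrite mem_iota; lia.
rewrite (bigD1_seq (pos x) mp (iota_uniq _ _)) /=.
rewrite olVK // eqxx mul1n big_seq_cond big1 ?addn0 // => i.
rewrite mem_iota => /andP[hi ne].
by rewrite ol_inj_pos ?(negPf ne) //; lia.
Qed.

Lemma mset_of_mult_bound f x : x \in mset_of_mult pi f -> 1 <= x <= n.
Proof. by rewrite in_mset mset_of_multE; case: ifP. Qed.

End StatMembership.

(** * Transfer of the statistics *)

(** By surjectivity the search succeeds and the default permutation is never returned. *)
Lemma Phi_FV_invK n : cancel (@Phi_FV_inv n) (@Phi_FV n).
Proof.
move=> W; rewrite /Phi_FV_inv; case: pickP => [pi /eqP //|none].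
by have [pi piW] := FV_surj W; have := none pi; rewrite piW eqxx.
Qed.

Lemma Phi_FV_inj n : injective (@Phi_FV n).
Proof. by move=> pi sg /(congr1 val) /FV_inj. Qed.

Lemma phiE n (pi : 'S_n) : Phi_FV (phi pi) = xi (Phi_FV pi).
Proof. exact: Phi_FV_invK. Qed.

Lemma phiK n : 1 <= n -> involutive (@phi n).
Proof.
by move=> hn pi; have [xiK _] := xiP hn; apply: Phi_FV_inj; rewrite !phiE xiK.
Qed.

(** * Two permutations whose histories are related by [xi_rel] *)

Section Transfer.
Variables (n : nat) (pi sg : 'S_n).
Hypotheses (n_gt0 : 1 <= n) (hxi : xi_rel (FV_triple pi) (FV_triple sg)).

Let hist := @xi_rel_ht n _ _ (FV_history pi) (FV_history sg) hxi n_gt0.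

Lemma last_xi : ol sg n = n.+1 - ol pi n.
Proof. by have [+ _ _ _] := hxi; rewrite !cs_FV. Qed.

Lemma last_bound (s : 'S_n) : 1 <= ol s n <= n.
Proof. by apply: ol_bound; lia. Qed.

Lemma is_dt_last (s : 'S_n) : is_dt (FV_letter s (ol s n)) = false.
Proof.
by rewrite is_dt_FV ?last_bound // olK ?ol_out ?n_gt0 //; have := last_bound s; lia.
Qed.

Lemma FV_lab_last (s : 'S_n) : FV_lab s (ol s n) = 0%R.
Proof.
have [_ + _] := history_cs (FV_history s) n_gt0.
by rewrite cs_FV // lab_FV // last_bound.
Qed.

Lemma xi_FV i : 1 <= i <= n ->
  [/\ is_dt (FV_letter sg (n.+1 - i)) = ~~ is_dt (FV_letter pi i) && (i != ol pi n),
      left_cross sg (n.+1 - i) = left_cross pi i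
    & FV_lab sg (n.+1 - i) = (FV_lab pi i - Posz (is_dt (FV_letter pi i))
                              + Posz (i < ol pi n))%R].
Proof.
move=> hi; have hj : 1 <= n.+1 - i <= n by lia.
have := hist hi; rewrite !letter_FV // !ht_FV // !lab_FV // cs_FV // => -[-> h l].
by split=> //; lia.
Qed.

Lemma xi_db i : 1 <= i < n ->
  is_db (FV_letter sg (n - i)) = ~~ is_db (FV_letter pi i).
Proof.
move=> hi; have hj : 1 <= n - i < n by lia.
have := history_htS (FV_history sg) hj; have := history_htS (FV_history pi) hi.
have -> : (n - i).+1 = n.+1 - i by lia.
have h1 : 1 <= i <= n by lia.
have h2 : 1 <= i.+1 <= n by lia.
have [_ l1 b1] := xi_FV h1; have [+ + +] := xi_FV h2; rewrite subSS => d2 l2 b2.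
rewrite !letter_FV ?ht_FV; try lia.
rewrite l1 b1 l2 b2 d2.
have := last_bound pi.
(* As in [height_xi_word], the missing complement at the last value is offset by the jump of the
   indicator. *)
have [e|] := eqVneq i.+1 (ol pi n); last first.
  by case: (is_dt (FV_letter pi i.+1)); case: is_db; case: is_db => //=; lia.
by rewrite -e ltnn (_ : is_dt (FV_letter pi i.+1) = false) ?e ?is_dt_last //;
  case: is_db; case: is_db => //=; lia.
Qed.

(** Away from the last value, tops and non-tops are exchanged, while complementation reverses the
    comparison with the last value. *)
Lemma xi_descents : [/\ Dtb pi = kappa n.+1 (Aba sg), Dta pi = kappa n.+1 (Abb sg),
  Abb pi = kappa n.+1 (Dta sg) & Aba pi = kappa n.+1 (Dtb sg)].
Proof.
have := last_bound pi; have := last_xi.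
split; apply/fsetP => x;
  (rewrite in_kappa => [|y]; last by rewrite !inE ?in_Ab ?in_Dt; lia);
  rewrite !inE ?in_Ab ?in_Dt ltnS; (have [hx|] := boolP (1 <= x <= n); last by lia);
  have [-> _ _] := xi_FV hx; case: is_dt => /=; lia.
Qed.

Lemma xi_Db : intv n.-1 `\` Db pi = kappa n (Db sg).
Proof.
apply/fsetP => x; rewrite in_kappa => [|y]; rewrite ?inE ?mem_iota ?in_Db; last first.
  (* The value [n] is never a descent bottom, so complementation at [n] stays within positive
     numbers. *)
  have [->|] := eqVneq y n; last by lia.
  have := history_dbn (FV_history sg) n_gt0; rewrite letter_FV => [->|]; lia.
have [hx|] := boolP (1 <= x < n); last by lia.
by rewrite xi_db //; case: is_db => /=; lia.
Qed.

(** With [a], [b] the left counts of [x.+1], [x] and [d] the bottom bit of [x], the condition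
    [a < b + d] turns into [b < a + (1 - d)], its negation. *)
Lemma xi_Ides : intv n.-1 `\` Ides pi = kappa n (Ides sg).
Proof.
apply/fsetP => x; rewrite in_kappa => [|y]; rewrite ?in_fsetD ?in_Ides; last by lia.
rewrite !inE ?mem_iota; have [hx|] := boolP (1 <= x < n); last by lia.
have [_ l1 _] := @xi_FV x ltac:(lia); have [_ l2 _] := @xi_FV x.+1 ltac:(lia).
rewrite xi_db // -l1 -l2 subSS (_ : n.+1 - x = (n - x).+1); last by lia.
by case: is_db => /=; lia.
Qed.

Lemma mset_of_mult_xi f g :
  (forall i, 1 <= i <= n -> f (ol pi^-1 i) = g (ol sg^-1 (n.+1 - i))) ->
  mset_of_mult pi f = mkappa n.+1 (mset_of_mult sg g).
Proof.
move=> fg; apply/msetP => x; rewrite mkappaE => [|y]; last exact: mset_of_mult_bound.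
rewrite !mset_of_multE ltnS; case: ifP => // hx; rewrite fg // ifT //; lia.
Qed.

(** Away from the last value, removing the complemented top bit from the label of [sg] leaves the
    label of [pi] minus 1 plus [i < ol pi n], the value in [count_213]. *)
Lemma xi_b2_u13 : b2_u13 pi = mkappa n.+1 (b2_u31 sg).
Proof.
apply: mset_of_mult_xi => i hi; have hj : 1 <= n.+1 - i <= n by lia.
rewrite !olVK //; have [d _ b] := xi_FV hi.
have := count_213 pi hi; have := FV_labE sg hj; rewrite b d.
have [->|ne] := eqVneq i (ol pi n); rewrite ?is_dt_last ?FV_lab_last ?ltnn; first by lia.
by case: is_dt; lia.
Qed.

(** Away from the last value, the indicators of lying below it for [pi] and for [sg] add up to 1 and
    absorb the [- 1] of [count_213]. *)
Lemma xi_b2_u31 : b2_u31 pi = mkappa n.+1 (b2_u13 sg).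
Proof.
apply: mset_of_mult_xi => i hi; have hj : 1 <= n.+1 - i <= n by lia.
rewrite !olVK //; have [d _ b] := xi_FV hi.
have := count_213 sg hj; have := FV_labE pi hi; rewrite b last_xi.
have := last_bound pi.
have [->|ne] := eqVneq i (ol pi n); rewrite ?is_dt_last ?FV_lab_last ?eqxx; first by lia.
have -> : (n.+1 - i == n.+1 - ol pi n) = false by lia.
by lia.
Qed.

Lemma xi_u31_b2 : u31_b2 pi = mkappa n.+1 (u31_b2 sg).
Proof.
apply: mset_of_mult_xi => i hi; have hj : 1 <= n.+1 - i <= n by lia.
by rewrite !olVK //; have [_ + _] := xi_FV hi; rewrite /left_cross => ->.
Qed.

End Transfer.

Theorem corollary4p3 (n : nat) (n_ge1 : (1 <= n)%N) :
  bijective (@phi n) /\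
  forall pi : 'S_n,
  [/\ (Dtb pi, Dta pi, Abb pi, Aba pi, b2_u13 pi, b2_u31 pi, u31_b2 pi) =
        (kappa n.+1 (Aba (phi pi)), kappa n.+1 (Abb (phi pi)),
         kappa n.+1 (Dta (phi pi)), kappa n.+1 (Dtb (phi pi)),
         mkappa n.+1 (b2_u31 (phi pi)), mkappa n.+1 (b2_u13 (phi pi)),
         mkappa n.+1 (u31_b2 (phi pi))),
      (intv n.-1 `\` Db pi)%fset = kappa n (Db (phi pi))
    & (intv n.-1 `\` Ides pi)%fset = kappa n (Ides (phi pi))].
Proof.
split; first exact: inv_bij (phiK n_ge1).
move=> pi; have hxi : xi_rel (FV_triple pi) (FV_triple (phi pi)).
  have [_ /(_ (Phi_FV pi))] := xiP n_ge1.
  by rewrite -phiE.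
split; [| exact: xi_Db n_ge1 hxi | exact: xi_Ides n_ge1 hxi].
have [-> -> -> ->] := xi_descents n_ge1 hxi.
by rewrite (xi_b2_u13 n_ge1 hxi) (xi_b2_u31 n_ge1 hxi) (xi_u31_b2 n_ge1 hxi).
Qed.
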